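(* Let $\mathcal{L}:\mathcal{M}_2\to\mathcal{M}_2$ be a linear map with $\operatorname{Tr}\mathcal{L}(X)=0$ for all $X\in\mathcal{M}_2$, and suppose that for every $t\ge 0$ the map $e^{t\mathcal{L}^\ddagger}$ is a unital Schwarz map. Let $\ell_1,\ell_2,\ell_3$ be the eigenvalues, counted with algebraic multiplicity, of the restriction of $\mathcal{L}$ to the (invariant) subspace $\mathcal{T}=\{X\in\mathcal{M}_2:\operatorname{Tr}X=0\}$, and set $\Gamma_k=-\operatorname{Re}\ell_k$ and $\Gamma=\Gamma_1+\Gamma_2+\Gamma_3$. Then $$\Gamma_k\le \tfrac{2}{3}\,\Gamma\qquad (k=1,2,3).$$
   Context: $\mathcal{M}_n$ denotes the complex $n\times n$ matrices. For a linear map $\Lambda$ on $\mathcal{M}_n$, its dual $\Lambda^\ddagger$ is defined by $\operatorname{Tr}\big((\Lambda^\ddagger(X))^\dagger Y\big)=\operatorname{Tr}\big(X^\dagger\Lambda(Y)\big)$ for all $X,Y$. A linear map $\Phi$ on $\mathcal{M}_n$ is unital if $\Phi(\mathbb{1})=\mathbb{1}$; a unital Schwarz map is a unital linear map satisfying $\Phi(X^\dagger X)\ge\Phi(X)^\dagger\Phi(X)$ (in the positive semidefinite order) for all $X\in\mathcal{M}_n$. The numbers $\Gamma_k$ are called relaxation rates. *)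

(* Defs.v *)
From HB Require Import structures.
From mathcomp Require Import all_boot all_order all_algebra.
From mathcomp Require Import complex.
From mathcomp Require Import all_classical all_reals all_analysis.
Set Implicit Arguments. Unset Strict Implicit. Unset Printing Implicit Defensive.
Import Order.TTheory GRing.Theory Num.Theory.
Import numFieldNormedType.Exports.
Local Open Scope ring_scope.

Section Defs.
Variable R : realType.
Local Notation C := (R[i]).

Definition adjm (m n : nat) (A : 'M[C]_(m, n)) : 'M[C]_(n, m) := (map_mx (@conjc R) A)^T.

Definition psd (n : nat) (A : 'M[C]_n) : Prop :=
  forall v : 'cV[C]_n, 0 <= ((adjm v) *m A *m v) 0 0.

Definition linmap (f : 'M[C]_2 -> 'M[C]_2) : Prop :=
  forall (a : C) (X Y : 'M[C]_2), f (a *: X + Y) = a *: f X + f Y.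

Definition is_dual (Ld L : 'M[C]_2 -> 'M[C]_2) : Prop :=
  forall X Y : 'M[C]_2, \tr (adjm (Ld X) *m Y) = \tr (adjm X *m L Y).

Definition unital_schwarz (Phi : 'M[C]_2 -> 'M[C]_2) : Prop :=
  linmap Phi /\ Phi 1%:M = 1%:M /\
  forall X : 'M[C]_2, psd (Phi (adjm X *m X) - adjm (Phi X) *m Phi X).

Definition exp_partial (t : R) (L : 'M[C]_2 -> 'M[C]_2) (X : 'M[C]_2) (N : nat)
  : 'M[C]_2 :=
  \sum_(k < N) ((t ^+ k / (k`!)%:R)%:C)%C *: iter k L X.

Definition expmap (t : R) (L : 'M[C]_2 -> 'M[C]_2) (X : 'M[C]_2) : 'M[C]_2 :=
  \matrix_(i < 2, j < 2)
    (Complex (limn (fun N => @complex.Re R (exp_partial t L X N i j)))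
             (limn (fun N => @complex.Im R (exp_partial t L X N i j)))).

Definition pauli (k : 'I_3) : 'M[C]_2 :=
  \matrix_(i < 2, j < 2)
    match nat_of_ord k, nat_of_ord i, nat_of_ord j with
    | 0, 0, 1 => 1 | 0, 1, 0 => 1
    | 1, 0, 1 => - 'i%C | 1, 1, 0 => 'i%C
    | 2, 0, 0 => 1 | 2, 1, 1 => -1
    | _, _, _ => 0
    end.

(* matrix of the restriction of L to T in the Pauli basis:
   L(sigma_j) = sum_i A i j sigma_i, with A i j = Tr(sigma_i L(sigma_j)) / 2 *)
Definition restrT (L : 'M[C]_2 -> 'M[C]_2) : 'M[C]_3 :=
  \matrix_(i < 3, j < 3) (\tr (pauli i *m L (pauli j)) / 2).

End Defs.

(* Main.v *)
Require Import Defs.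
From HB Require Import structures.
From mathcomp Require Import all_boot all_order all_algebra.
From mathcomp Require Import complex.
From mathcomp Require Import all_classical all_reals all_analysis.
From mathcomp Require Import ring lra.
Import Order.TTheory GRing.Theory Num.Theory.
Import numFieldNormedType.Exports.
Local Open Scope ring_scope.

(* Differentiating the Schwarz inequality for [exp (t L^dual)] at [t = 0] and
   passing to the predual gives, for every vector [psi] and every [X],
     [2 Re tr (X^* L (X rho)) <= tr (X^* X L rho)]  with  [rho = psi psi^*].
   Take [X = phi psi^*] where [phi] is orthogonal to [psi] and of equal norm,
   and add the inequality with [psi] and [phi] exchanged.  If [n] is the unit
   Bloch vector of [psi] and [A] the (real) matrix of [L] in the Pauli basis,
   this reads [2 (tr A - n A n) <= n A n], that is [2 tr A <= 3 n A n].
   Applied to the real and imaginary parts of an eigenvector of [A] for the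
   eigenvalue [l], it yields [2 tr A <= 3 Re l], and [tr A] is the sum of the
   eigenvalues. *)

(** * First-order expansion of scalar exponential series *)

(** Since [t <= 1], the terms of index at least two are dominated by [t ^+ 2] times those of the
    series [C * exp_coeff K], whose sum is [C * expR K]. *)
Lemma exp_series_taylor1 (R : realType) (a : nat -> R) (C K t : R) :
  0 <= C -> 0 <= K -> (forall k, `|a k| <= C * K ^+ k) -> 0 <= t <= 1 ->
  `|limn (fun N => \sum_(k < N) (t ^+ k / k`!%:R) * a k) - (a 0%N + t * a 1%N)|
    <= t ^+ 2 * (C * expR K).
Proof.
move=> C0 K0 aCK /andP[t0 t1].
pose b : R^nat := fun k => t ^+ k / k`!%:R * a k.
pose e : R^nat := fun k => C * exp_coeff K k.
have e0 k : 0 <= e k by rewrite mulr_ge0 ?exp_coeff_ge0.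
(* The case [j = 0] gives the convergence of [series b], the case [j = 2] the size of the
   remainder. *)
have bound k j : (j <= k)%N -> `|b k| <= t ^+ j * e k.
  move=> jk; rewrite /b normrM ger0_norm ?divr_ge0 ?exprn_ge0 //.
  apply: (@le_trans _ _ (t ^+ k / k`!%:R * (C * K ^+ k))).
    by rewrite ler_wpM2l ?divr_ge0 ?exprn_ge0.
  rewrite (_ : _ * _ = t ^+ k * e k); last by rewrite /e /exp_coeff /=; ring.
  by rewrite ler_wpM2r // ler_wiXn2l.
have cvg_e : cvgn (series e) by apply: is_cvg_seriesZ; exact: is_cvg_series_exp_coeff.
have lim_e : limn (series e) = C * expR K.
  by rewrite lim_seriesZ //; exact: is_cvg_series_exp_coeff.
have cvg_b : cvgn (series b).
  apply: normed_cvg; apply: series_le_cvg cvg_e => //= k.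
  by have := bound k 0%N (leq0n k); rewrite expr0 mul1r.
have partial n : `|series b n.+2 - (a 0%N + t * a 1%N)| <= t ^+ 2 * (C * expR K).
  rewrite /series /= big_nat_recl // big_nat_recl //.
  rewrite (_ : _ - _ = \sum_(0 <= k < n) b k.+2); last by rewrite /b !factS fact0; field.
  apply: le_trans (ler_norm_sum _ _ _) _.
  apply: (@le_trans _ _ (\sum_(0 <= k < n) t ^+ 2 * e k.+2)).
    by apply: ler_sum => k _; exact: bound.
  rewrite -mulr_sumr ler_wpM2l ?exprn_ge0 // -lim_e.
  apply: (@le_trans _ _ (series e n.+2)).
    by rewrite /series /= big_nat_recl // big_nat_recl // addrA lerDr addr_ge0.
  by apply: nondecreasing_cvgn_le => //; exact/nondecreasing_series.
rewrite (_ : (fun N => _) = series b); last first.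
  by apply/funext => N; rewrite /series /= big_mkord.
rewrite ler_norml; apply/andP; split.
  (* The estimate on partial sums starts at two terms, once the constant and linear terms are both
     present. *)
  rewrite lerBrDl; apply: limr_ge => //; exists 2%N => //= -[|[|n]] //= _.
  by have := partial n; rewrite ler_norml lerBrDl => /andP[].
rewrite lerBlDl; apply: limr_le => //; exists 2%N => //= -[|[|n]] //= _.
by have := partial n; rewrite ler_norml lerBlDl => /andP[].
Qed.

(** This differentiates at [t = 0] an inequality that is an equality there: a quadratic error cannot
    compensate a negative slope for small [t]. *)
Lemma slope_ge0 (R : realType) (c K : R) : 0 <= K ->
  (forall t, 0 <= t <= 1 -> 0 <= t * c + t ^+ 2 * K) -> 0 <= c.
Proof.
move=> K0 h; rewrite leNgt; apply/negP => c0.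
have d0 : 0 < - c + K by lra.
(* For [c < 0] this choice of [t] lies in []0, 1]] and gives
   [c + t * K = - c ^+ 2 / (- c + K) < 0]. *)
have t0 : 0 < - c / (- c + K) by rewrite divr_gt0 // oppr_gt0.
have := h (- c / (- c + K)); rewrite ltW //= ler_pdivrMr // mul1r lerDl => /(_ K0).
rewrite expr2 -mulrA -mulrDr pmulr_rge0 // => h1.
have : 0 <= (c + - c / (- c + K) * K) * (- c + K) by rewrite mulr_ge0 // ltW.
rewrite mulrDl mulrAC divfK ?gt_eqF // => h2; nra.
Qed.

(** * Complex arithmetic, adjoints and traces *)

Section Qubit.
Variable R : realType.
Local Notation C := (R[i]).
Implicit Types (X Y Z : 'M[C]_2).

Lemma cReD (x y : C) : complex.Re (x + y) = complex.Re x + complex.Re y.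
Proof. by case: x y => ? ? []. Qed.

Lemma cReB (x y : C) : complex.Re (x - y) = complex.Re x - complex.Re y.
Proof. by case: x y => ? ? []. Qed.

Lemma cReM (x y : C) : complex.Re (x * y) =
  complex.Re x * complex.Re y - complex.Im x * complex.Im y.
Proof. by case: x y => ? ? []. Qed.

Lemma cReN (x : C) : complex.Re (- x) = - complex.Re x.
Proof. by case: x. Qed.

Lemma cReJ (z : C) : complex.Re (z^*)%C = complex.Re z.
Proof. by case: z. Qed.

Lemma cImD (x y : C) : complex.Im (x + y) = complex.Im x + complex.Im y.
Proof. by case: x y => ? ? []. Qed.

Lemma cImB (x y : C) : complex.Im (x - y) = complex.Im x - complex.Im y.
Proof. by case: x y => ? ? []. Qed.

Lemma cImM (x y : C) : complex.Im (x * y) =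
  complex.Re x * complex.Im y + complex.Im x * complex.Re y.
Proof. by case: x y => ? ? []. Qed.

Lemma cImN (x : C) : complex.Im (- x) = - complex.Im x.
Proof. by case: x. Qed.

Lemma cImJ (z : C) : complex.Im (z^*)%C = - complex.Im z.
Proof. by case: z. Qed.

Lemma Re2 : complex.Re (2 : C) = 2. Proof. by []. Qed.

Lemma Im2 : complex.Im (2 : C) = 0. Proof. by rewrite /= addr0. Qed.

Definition ReImE := (Re2, Im2, cReD, cImD, cReM, cImM, cReN, cImN, cReJ, cImJ).

Lemma complex_eqP (x y : C) :
  complex.Re x = complex.Re y -> complex.Im x = complex.Im y -> x = y.
Proof. by case: x y => ? ? [? ?] /= -> ->. Qed.

Lemma real_complex_Re (r : R) (z : C) : complex.Re (r%:C%C * z) = r * complex.Re z.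
Proof. by case: z => a b /=; rewrite mul0r subr0. Qed.

Lemma real_complex_Im (r : R) (z : C) : complex.Im (r%:C%C * z) = r * complex.Im z.
Proof. by case: z => a b /=; rewrite mul0r addr0. Qed.

Lemma normc_ge_ReIm (z : C) (r : R) : `|z| <= r%:C%C ->
  `|complex.Re z| <= r /\ `|complex.Im z| <= r.
Proof.
move=> zr; split; first by rewrite -lecR (le_trans (normc_ge_Re z)).
rewrite -lecR -normrN -ReiNIm; apply: le_trans (normc_ge_Re _) _.
by rewrite normrM (normc_def 'i%C) /= expr0n expr1n add0r sqrtr1 mulr1.
Qed.

Lemma adjmM m n p (A : 'M[C]_(m, n)) (B : 'M[C]_(n, p)) :
  adjm (A *m B) = adjm B *m adjm A.
Proof. by rewrite /adjm map_mxM trmx_mul. Qed.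

Lemma adjmB m n (A B : 'M[C]_(m, n)) : adjm (A - B) = adjm A - adjm B.
Proof. by rewrite /adjm map_mxB linearB. Qed.

Lemma adjmK m n (A : 'M[C]_(m, n)) : adjm (adjm A) = A.
Proof. by apply/matrixP => i j; rewrite !mxE conjcK. Qed.

Lemma mxtrace_adjm n (A : 'M[C]_n) : \tr (adjm A) = ((\tr A)^*)%C.
Proof. by rewrite /mxtrace rmorph_sum; apply: eq_bigr => i _; rewrite !mxE. Qed.

Lemma Re_trB (A B D : 'M[C]_2) : complex.Re (\tr (A *m (B - D))) =
  complex.Re (\tr (A *m B)) - complex.Re (\tr (A *m D)).
Proof. by rewrite mulmxBr -cReB; congr complex.Re; exact: raddfB. Qed.

Lemma quadform_tr (psi : 'cV[C]_2) A :
  (adjm psi *m A *m psi) 0 0 = \tr (psi *m adjm psi *m A).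
Proof. by rewrite -[X in \tr X]mulmxA mxtrace_mulC /mxtrace big_ord1. Qed.

(** The trace is the squared norm of [X *m psi]. *)
Lemma gram_tr_ge0 (psi : 'cV[C]_2) X :
  0 <= \tr (psi *m adjm psi *m (adjm X *m X)).
Proof.
rewrite -quadform_tr mulmxA -mulmxA -adjmM.
rewrite mxE; apply: sumr_ge0 => i _; rewrite !mxE mulrC -sqr_normc.
by rewrite exprn_ge0.
Qed.

(* Adding [(Y - X)^* (Y - X) >= 0] makes the Schwarz inequality linear in [Y],
   so that only first-order expansions of the semigroup itself are needed. *)
Lemma schwarz_linearized (psi : 'cV[C]_2) X Y Z :
  0 <= \tr (psi *m adjm psi *m (Z - adjm Y *m Y)) ->
  2 * complex.Re (\tr (psi *m adjm psi *m adjm X *m Y)) <=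
  complex.Re (\tr (psi *m adjm psi *m Z))
    + complex.Re (\tr (psi *m adjm psi *m (adjm X *m X))).
Proof.
set rho := psi *m adjm psi; move=> ZY.
have sqr_ge0 : 0 <= \tr (rho *m (adjm (Y - X) *m (Y - X))) by exact: gram_tr_ge0.
have rhoH : adjm rho = rho by rewrite /rho adjmM adjmK.
clearbody rho.
have adjE : complex.Re (\tr (rho *m (adjm Y *m X))) = complex.Re (\tr (rho *m (adjm X *m Y))).
  by rewrite -cReJ -mxtrace_adjm !adjmM adjmK rhoH mxtrace_mulC.
have expand : adjm (Y - X) *m (Y - X) =
    adjm Y *m Y - adjm Y *m X - (adjm X *m Y - adjm X *m X).
  by rewrite adjmB mulmxBl !mulmxBr.
rewrite expand in sqr_ge0; rewrite -(mulmxA rho).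
(* [q] is kept abstract because [lra] is very slow on atoms that are traces. *)
have algebra (q : 'M[C]_2 -> R) (yy yx xy xx : 'M[C]_2) :
    (forall A B, q (A - B) = q A - q B) -> q yx = q xy ->
    0 <= q (Z - yy) -> 0 <= q (yy - yx - (xy - xx)) -> 2 * q xy <= q Z + q xx.
  by move=> qB; rewrite !qB; lra.
have Re_ge0 (z : C) : 0 <= z -> 0 <= complex.Re z by rewrite lecE => /andP[].
exact: (algebra (fun A => complex.Re (\tr (rho *m A))) _ _ _ _
  (Re_trB rho) adjE (Re_ge0 _ ZY) (Re_ge0 _ sqr_ge0)).
Qed.

(** * Pauli coordinates and real quadratic forms *)

Definition triple {T : nmodType} (a b c : T) (k : 'I_3) : T := nth 0 [:: a; b; c] k.

Lemma tripleE (T : nmodType) (u : 'I_3 -> T) :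
  u = triple (u ord0) (u (lift ord0 ord0)) (u (lift ord0 (lift ord0 ord0))).
Proof.
by apply/funext => -[[|[|[|//]]] ?]; rewrite /triple /=; congr u; exact: val_inj.
Qed.

Definition sigma (u : 'I_3 -> C) : 'M[C]_2 := \sum_k u k *: pauli R k.

Lemma sigmaE a b c : sigma (triple a b c) = \matrix_(i < 2, j < 2)
  match nat_of_ord i, nat_of_ord j with
  | 0, 0 => c | 0, 1 => a - 'i%C * b | 1, 0 => a + 'i%C * b | _, _ => - c end.
Proof.
apply/matrixP => i j; rewrite /sigma !big_ord_recl big_ord0 !mxE /=.
case: i => [[|[|//]] ?]; case: j => [[|[|//]] ?]; rewrite /triple /=.
all: by apply: complex_eqP; rewrite !ReImE /=; ring.
Qed.

(** Spectral decomposition: the witnesses [psi] and [phi] are eigenvectors for [1] and [-1], and [c]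
    is the inverse of their common squared norm. *)
Lemma pauli_rank1 k : exists (c : R) (psi phi : 'cV[C]_2),
  pauli R k = c%:C%C *: (psi *m adjm psi - phi *m adjm phi).
Proof.
pose v (a b : C) : 'cV[C]_2 := \col_(i < 2) if nat_of_ord i is 0 then a else b.
case: k => [[|[|[|//]]] ?].
- exists 2^-1, (v 1 1), (v 1 (-1)); apply/matrixP => i j; rewrite !mxE !big_ord1 !mxE /=.
  case: i => [[|[|//]] ?]; case: j => [[|[|//]] ?] /=;
    by apply: complex_eqP; rewrite !ReImE /=; field.
- exists 2^-1, (v 1 'i%C), (v 1 (- 'i%C)); apply/matrixP => i j; rewrite !mxE !big_ord1 !mxE /=.
  case: i => [[|[|//]] ?]; case: j => [[|[|//]] ?] /=;
    by apply: complex_eqP; rewrite !ReImE /=; field.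
- exists 1, (v 1 0), (v 0 1); apply/matrixP => i j; rewrite !mxE !big_ord1 !mxE /=.
  case: i => [[|[|//]] ?]; case: j => [[|[|//]] ?] /=;
    by apply: complex_eqP; rewrite !ReImE /=; field.
Qed.

(** Only real parts enter, because the matrix of interest has real entries by [restrT_real]. *)
Definition qform (A : 'M[C]_3) (n : 'I_3 -> R) : R :=
  \sum_i \sum_j n i * n j * complex.Re (A i j).

Lemma qformZ (A : 'M[C]_3) (n : 'I_3 -> R) (c : R) :
  qform A (fun k => c * n k) = c ^+ 2 * qform A n.
Proof.
rewrite /qform mulr_sumr; apply: eq_bigr => i _; rewrite mulr_sumr.
by apply: eq_bigr => j _; ring.
Qed.

Lemma Re_form (A : 'M[C]_3) (u v : 'I_3 -> C) : (forall i j, complex.Im (A i j) = 0) ->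
  complex.Re (\sum_i \sum_j u i * v j * A i j) = \sum_i \sum_j
   (complex.Re (u i) * complex.Re (v j) - complex.Im (u i) * complex.Im (v j))
     * complex.Re (A i j).
Proof.
move=> A0; rewrite (raddf_sum (@complex.Re R)); apply: eq_bigr => i _.
rewrite (raddf_sum (@complex.Re R)); apply: eq_bigr => j _ /=.
by rewrite cReM A0 mulr0 subr0 cReM.
Qed.

(* For [psi = (p, q + i s)] and [phi = (- q + i s, p)], the last form is taken
   at the Bloch vector of [psi]; the first two at the real and imaginary parts
   of the Pauli coordinates of [phi psi^*].  These three vectors are orthogonal. *)
Lemma form_spinor_identity (A : 'M[C]_3) (p q s : R) :
  4 * (qform A (triple ((p ^+ 2 - q ^+ 2 + s ^+ 2) / 2) (- (q * s)) (- (p * q)))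
     + qform A (triple (q * s) (- (p ^+ 2 + q ^+ 2 - s ^+ 2) / 2) (p * s)))
  + qform A (triple (2 * p * q) (2 * p * s) (p ^+ 2 - q ^+ 2 - s ^+ 2))
  = (p ^+ 2 + q ^+ 2 + s ^+ 2) ^+ 2 * complex.Re (\tr A).
Proof.
by rewrite /qform /mxtrace !big_ord_recl !big_ord0 !ReImE /triple /=; field.
Qed.

(** * First-order expansion of the dual semigroup *)

Section Generator.
Variables L M : 'M[C]_2 -> 'M[C]_2.
Hypothesis linL : linmap L.
Hypothesis trL : forall X, \tr (L X) = 0.
Hypothesis dML : is_dual M L.
Hypothesis sch : forall t : R, 0 <= t -> unital_schwarz (expmap t M).

(** Pairing with a matrix unit reads off an entry of [M X], so that bounds on [L] control [M]. *)
Lemma dual_entry X i j :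
  M X i j = ((\tr (adjm X *m L (delta_mx i j)))^*)%C.
Proof.
rewrite -dML /mxtrace (bigD1 j) //= big1 ?addr0 => [|k kj]; rewrite !mxE.
  rewrite (bigD1 i) //= big1 ?addr0 => [|k ki]; rewrite !mxE ?eqxx ?mulr1 ?conjcK //.
  by rewrite (negbTE ki) mulr0.
by rewrite big1 // => m _; rewrite !mxE (negbTE kj) andbF mulr0.
Qed.

(** In the entrywise l1 norm [S], one application of [M] multiplies the norm by at most [K], the sum
    of the norms of the images of the matrix units under [L]. *)
Lemma dual_iter_bound X :
  exists C0 K : R, [/\ 0 <= C0, 0 <= K &
    forall k i j, `|iter k M X i j| <= (C0 * K ^+ k)%:C%C].
Proof.
pose S Y : C := \sum_i \sum_j `|Y i j|.
have SE Y i j : `|Y i j| <= S Y.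
  rewrite /S (bigD1 i) //= (bigD1 j) //= -addrA lerDl addr_ge0 ?sumr_ge0 //.
  by move=> *; rewrite sumr_ge0.
have S0 Y : 0 <= S Y by do 2![rewrite sumr_ge0 // => *].
pose K := \sum_i \sum_j S (L (delta_mx i j)).
have K0 : 0 <= K by do 2![rewrite sumr_ge0 // => *].
have step Y : S (M Y) <= S Y * K.
  rewrite /S -/(S Y) /K mulr_sumr ler_sum // => i _.
  rewrite mulr_sumr ler_sum // => j _.
  rewrite dual_entry normcJ /mxtrace /S exchange_big mulr_suml.
  apply: le_trans (ler_norm_sum _ _ _) _; apply: ler_sum => k _.
  rewrite mxE mulr_suml; apply: le_trans (ler_norm_sum _ _ _) _.
  apply: ler_sum => m _; rewrite normrM !mxE normcJ ler_wpM2l //.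
have it k : S (iter k M X) <= S X * K ^+ k.
  elim: k => [|k IH]; first by rewrite mulr1.
  by rewrite iterS exprSr mulrA; apply: le_trans (step _) _; rewrite ler_wpM2r.
(* The norms so far are elements of [C]; being nonnegative they are real, and equal to their real
   parts. *)
have RK : (complex.Re K)%:C%C = K by rewrite RRe_real // ger0_real.
have RS : (complex.Re (S X))%:C%C = S X by rewrite RRe_real // ger0_real.
exists (complex.Re (S X)), (complex.Re K); split.
- by rewrite -lecR RS.
- by rewrite -lecR RK.
move=> k i j; rewrite rmorphM rmorphXn /= RK RS.
exact: le_trans (SE _ _ _) (it _).
Qed.

(** [expmap] takes limits of real and imaginary parts separately, so the scalar expansion is applied
    to each. *)
Lemma expmap_taylor1 X :
  exists2 K : R, 0 <= K & forall t i j, 0 <= t <= 1 ->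
    `|complex.Re (expmap t M X i j) - (complex.Re (X i j) + t * complex.Re (M X i j))|
       <= t ^+ 2 * K /\
    `|complex.Im (expmap t M X i j) - (complex.Im (X i j) + t * complex.Im (M X i j))|
       <= t ^+ 2 * K.
Proof.
have [C0 [K [C00 K0 it]]] := dual_iter_bound X.
exists (C0 * expR K); first by rewrite mulr_ge0 ?expR_ge0.
move=> t i j t01; rewrite /expmap !mxE /=; split.
- rewrite (_ : (fun N => _) = fun N => \sum_(k < N) (t ^+ k / k`!%:R) *
     complex.Re (iter k M X i j)).
    apply: (exp_series_taylor1 R (fun k => complex.Re (iter k M X i j))) => // k.
    by have [] := normc_ge_ReIm _ _ (it k i j).
  apply/funext => N; rewrite /exp_partial summxE (raddf_sum (@complex.Re R)).
  by apply: eq_bigr => k _; rewrite mxE; exact: real_complex_Re.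
- rewrite (_ : (fun N => _) = fun N => \sum_(k < N) (t ^+ k / k`!%:R) *
     complex.Im (iter k M X i j)).
    apply: (exp_series_taylor1 R (fun k => complex.Im (iter k M X i j))) => // k.
    by have [] := normc_ge_ReIm _ _ (it k i j).
  apply/funext => N; rewrite /exp_partial summxE (raddf_sum (@complex.Im R)).
  by apply: eq_bigr => k _; rewrite mxE; exact: real_complex_Im.
Qed.

Lemma expmap_tr_taylor1 (B : 'M[C]_2) X :
  exists2 K : R, 0 <= K & forall t, 0 <= t <= 1 ->
    `|complex.Re (\tr (B *m expmap t M X))
      - (complex.Re (\tr (B *m X)) + t * complex.Re (\tr (B *m M X)))| <= t ^+ 2 * K.
Proof.
have [K K0 tay] := expmap_taylor1 X.
have trE Y : complex.Re (\tr (B *m Y)) = \sum_i \sum_j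
    (complex.Re (B i j) * complex.Re (Y j i) - complex.Im (B i j) * complex.Im (Y j i)).
  rewrite /mxtrace (raddf_sum (@complex.Re R)); apply: eq_bigr => i _.
  rewrite mxE (raddf_sum (@complex.Re R)); apply: eq_bigr => j _; exact: cReM.
pose S := \sum_i \sum_j (`|complex.Re (B i j)| + `|complex.Im (B i j)|).
have S0 : 0 <= S by do 2![apply: sumr_ge0 => ? _]; rewrite addr_ge0.
exists (S * K) => [|t t01]; first by rewrite mulr_ge0.
rewrite !trE mulr_sumr -big_split -sumrB /S mulrCA mulr_suml.
apply: le_trans (ler_norm_sum _ _ _) _; apply: ler_sum => i _.
rewrite mulr_sumr -big_split -sumrB mulr_suml.
apply: le_trans (ler_norm_sum _ _ _) _; apply: ler_sum => j _ /=.
have [hRe hIm] := tay t j i t01.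
set x := complex.Re (expmap _ _ _ _ _) in hRe *.
set y := complex.Im (expmap _ _ _ _ _) in hIm *.
rewrite (_ : _ - _ - _ = complex.Re (B i j) *
    (x - (complex.Re (X j i) + t * complex.Re (M X j i))) - complex.Im (B i j) *
    (y - (complex.Im (X j i) + t * complex.Im (M X j i)))); last by ring.
apply: le_trans (ler_normB _ _) _; rewrite !normrM mulrDl.
by rewrite lerD // ler_wpM2l.
Qed.

(** * The Schwarz inequality differentiated at time zero *)

(** By the Schwarz property, [\tr (rho *m expmap t M (adjm X *m X))] is a sum of two nonnegative
    numbers, hence real for all [t >= 0]; so is its derivative at [0]. *)
Lemma schwarz_real (psi : 'cV[C]_2) X :
  complex.Im (\tr (psi *m adjm psi *m M (adjm X *m X))) = 0.
Proof.
set rho := psi *m adjm psi.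
have gram (Z : 'M[C]_2) : complex.Im (\tr (rho *m (adjm Z *m Z))) = 0.
  by apply: ger0_Im; exact: gram_tr_ge0.
(* As [Re (- i z) = Im z], this weight turns the expansion of real parts into one of imaginary
   parts. *)
have [K K0 tay] := expmap_tr_taylor1 (- 'i%C *: rho) (adjm X *m X).
have ReE Z : complex.Re (\tr (- 'i%C *: rho *m Z)) = complex.Im (\tr (rho *m Z)).
  by rewrite -scalemxAl mxtraceZ mulNr mulrC -mulNr ReiNIm; case: (\tr _) => ? ?; rewrite /= opprK.
have im0 t : 0 <= t -> complex.Im (\tr (rho *m expmap t M (adjm X *m X))) = 0.
  move=> t0; have [_ [_ /(_ X)]] := sch t t0; move=> /(_ psi).
  rewrite quadform_tr -/rho => /ger0_Im.
  by rewrite mulmxBr raddfB /= cImB gram subr0.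
apply/eqP; rewrite eq_le -oppr_ge0; apply/andP; split.
all: apply: slope_ge0 K0 _ => t t01; have /andP[t0 _] := t01.
all: have := tay t t01; rewrite !ReE im0 // gram ler_norml => /andP[]; lra.
Qed.

(** At [t = 0] both sides of [schwarz_linearized] are twice the real part of
    [\tr (rho *m adjm X *m X)], so the inequality passes to the derivatives. *)
Lemma schwarz_dissipative (psi : 'cV[C]_2) X :
  2 * complex.Re (\tr (psi *m adjm psi *m adjm X *m M X))
    <= complex.Re (\tr (psi *m adjm psi *m M (adjm X *m X))).
Proof.
set rho := psi *m adjm psi; set P := adjm X *m X.
have [K1 K10 tay1] := expmap_tr_taylor1 rho P.
have [K2 K20 tay2] := expmap_tr_taylor1 (rho *m adjm X) X.
have algebra (t xX yX mX xP yP mP : R) :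
    `|yP - (xP + t * mP)| <= t ^+ 2 * K1 -> `|yX - (xX + t * mX)| <= t ^+ 2 * K2 ->
    xX = xP -> 2 * yX <= yP + xP -> 0 <= t * (mP - 2 * mX) + t ^+ 2 * (K1 + 2 * K2).
  by rewrite !ler_norml => /andP[? ?] /andP[? ?] ? ?; lra.
rewrite -subr_ge0; apply: (@slope_ge0 _ _ (K1 + 2 * K2)) => [|t t01].
  by rewrite addr_ge0 // mulr_ge0.
have /andP[t0 _] := t01.
have [_ [_ /(_ X) /(_ psi)]] := sch t t0; rewrite quadform_tr => /schwarz_linearized lin.
apply: algebra (tay1 t t01) (tay2 t t01) _ (lin X).
by rewrite -(mulmxA rho (adjm X) X).
Qed.

(** * Passage from the dual to [L] itself *)

Lemma linmapD X Y : L (X + Y) = L X + L Y.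
Proof. by have := linL 1 X Y; rewrite !scale1r. Qed.

Lemma linmap0 : L 0 = 0.
Proof. by apply: (addrI (L 0)); rewrite -linmapD !addr0. Qed.

Lemma linmapZ a X : L (a *: X) = a *: L X.
Proof. by rewrite -[a *: X]addr0 linL linmap0 addr0. Qed.

Lemma linmap_sum (I : finType) (F : I -> 'M[C]_2) : L (\sum_i F i) = \sum_i L (F i).
Proof. by apply: big_morph; [exact: linmapD | exact: linmap0]. Qed.

Lemma dual_tr X Y : \tr (adjm Y *m M X) = ((\tr (adjm X *m L Y))^*)%C.
Proof. by rewrite -dML -mxtrace_adjm adjmM adjmK. Qed.

Lemma dissipative_predual (psi : 'cV[C]_2) X :
  2 * complex.Re (\tr (adjm X *m L (X *m (psi *m adjm psi))))
    <= complex.Re (\tr (adjm X *m X *m L (psi *m adjm psi))).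
Proof.
have := schwarz_dissipative psi X.
have : adjm (psi *m adjm psi) = psi *m adjm psi by rewrite adjmM adjmK.
move: (psi *m adjm psi) => rho rhoH.
have -> : rho *m adjm X = adjm (X *m rho) by rewrite adjmM rhoH.
by rewrite -[in X in _ <= X -> _]rhoH !dual_tr !cReJ adjmM adjmK.
Qed.

(** This is [schwarz_real] moved to [L] by duality, for an [X] with [adjm X *m X = phi *m adjm phi];
    such an [X] is [e *m adjm phi] with [e] a unit vector. *)
Lemma hermitian_predual (psi phi : 'cV[C]_2) :
  complex.Im (\tr (phi *m adjm phi *m L (psi *m adjm psi))) = 0.
Proof.
pose e : 'cV[C]_2 := delta_mx 0 0.
have := schwarz_real psi (e *m adjm phi).
have -> : adjm (e *m adjm phi) *m (e *m adjm phi) = phi *m adjm phi.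
  rewrite adjmM adjmK -!mulmxA; congr (_ *m _); rewrite mulmxA.
  rewrite (_ : adjm e *m e = 1%:M) ?mul1mx //; apply/matrixP => i j.
  rewrite !ord1 !mxE big_ord_recl big_ord1 !mxE /=.
  by apply: complex_eqP; rewrite !ReImE /=; ring.
have rhoH : adjm (psi *m adjm psi) = psi *m adjm psi by rewrite adjmM adjmK.
rewrite -{1}rhoH dual_tr cImJ adjmM adjmK => /eqP.
by rewrite oppr_eq0 => /eqP.
Qed.

Lemma tr_sigma u v :
  \tr (sigma u *m L (sigma v)) = 2 * \sum_i \sum_j u i * v j * restrT L i j.
Proof.
rewrite {2}/sigma linmap_sum mulmx_sumr raddf_sum /=.
rewrite [in RHS]exchange_big mulr_sumr /=; apply: eq_bigr => j _.
rewrite linmapZ -scalemxAr mxtraceZ /sigma mulmx_suml raddf_sum /= !mulr_sumr.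
apply: eq_bigr => i _; rewrite -scalemxAl mxtraceZ mxE.
by field.
Qed.

(** By [pauli_rank1] each entry is a real combination of traces of the kind treated in
    [hermitian_predual]. *)
Lemma restrT_real i j : complex.Im (restrT L i j) = 0.
Proof.
rewrite mxE; have [c [psi [phi ->]]] := pauli_rank1 i.
have [d [psi' [phi' ->]]] := pauli_rank1 j.
have := hermitian_predual psi' psi; have := hermitian_predual psi' phi.
have := hermitian_predual phi' psi; have := hermitian_predual phi' phi.
move: (psi *m _) (phi *m _) (psi' *m _) (phi' *m _) => P Q P' Q'.
have -> : L (d%:C%C *: (P' - Q')) = d%:C%C *: (L P' - L Q').
  by rewrite linmapZ linmapD -scaleN1r linmapZ scaleN1r.
move: (L P') (L Q') => U V h1 h2 h3 h4.
have -> : \tr (c%:C%C *: (P - Q) *m (d%:C%C *: (U - V))) =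
    (c * d)%:C%C * (\tr (P *m U) - \tr (P *m V) - (\tr (Q *m U) - \tr (Q *m V))).
  rewrite -scalemxAl -scalemxAr !mxtraceZ mulrA -rmorphM mulmxBl !mulmxBr.
  by rewrite !(raddfB (@mxtrace _ 2)).
have -> : (2 : C)^-1 = (2^-1)%:C%C by rewrite fmorphV rmorph_nat.
by rewrite !ReImE h1 h2 h3 h4 /=; ring.
Qed.

(** * The inequality on Bloch vectors *)

(** With [X = phi psi^*] and [rho = psi psi^*], the norms give [X rho = N X] and [X^* X = N rho],
    and [N] cancels from [dissipative_predual]. *)
Lemma dissipative_flip (psi phi : 'cV[C]_2) (N : R) : 0 < N ->
  adjm psi *m psi = (N%:C%C)%:M -> adjm phi *m phi = (N%:C%C)%:M ->
  2 * complex.Re (\tr (psi *m adjm phi *m L (phi *m adjm psi)))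
    <= complex.Re (\tr (psi *m adjm psi *m L (psi *m adjm psi))).
Proof.
move=> N0 Npsi Nphi; rewrite -(ler_pM2l N0).
have := dissipative_predual psi (phi *m adjm psi).
rewrite adjmM adjmK.
have -> : phi *m adjm psi *m (psi *m adjm psi) = N%:C%C *: (phi *m adjm psi).
  by rewrite mulmxA -(mulmxA phi) Npsi mul_mx_scalar scalemxAl.
have -> : psi *m adjm phi *m (phi *m adjm psi) = N%:C%C *: (psi *m adjm psi).
  by rewrite mulmxA -(mulmxA psi) Nphi mul_mx_scalar scalemxAl.
rewrite linmapZ -scalemxAl -scalemxAr !mxtraceZ !real_complex_Re.
by rewrite mulrCA.
Qed.

(** The two instances of [dissipative_flip], with [psi] and [phi] exchanged, add up to
    [8 (qform a + qform b) <= qform n]; [form_spinor_identity] then trades [a] and [b] for the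
    trace. *)
Lemma bloch_spinor (p q s : R) : 0 < p ^+ 2 + q ^+ 2 + s ^+ 2 ->
  2 * ((p ^+ 2 + q ^+ 2 + s ^+ 2) ^+ 2 * complex.Re (\tr (restrT L))) <=
  3 * qform (restrT L) (triple (2 * p * q) (2 * p * s) (p ^+ 2 - q ^+ 2 - s ^+ 2)).
Proof.
move=> N0; rewrite -form_spinor_identity.
set a := triple _ _ _; set b := triple (q * s) _ _; set n := triple (2 * p * q) _ _.
set N := p ^+ 2 + q ^+ 2 + s ^+ 2 in N0.
pose col2 (z w : C) : 'cV[C]_2 := \col_(i < 2) if nat_of_ord i is 0 then z else w.
pose psi := col2 p%:C%C (q +i* s)%C; pose phi := col2 (- q +i* s)%C p%:C%C.
have Npsi : adjm psi *m psi = (N%:C%C)%:M.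
  apply/matrixP => i j; rewrite !ord1 !mxE big_ord_recl big_ord1 !mxE /=.
  by apply: complex_eqP; rewrite !ReImE /= /N; ring.
have Nphi : adjm phi *m phi = (N%:C%C)%:M.
  apply/matrixP => i j; rewrite !ord1 !mxE big_ord_recl big_ord1 !mxE /=.
  by apply: complex_eqP; rewrite !ReImE /= /N; ring.
(* [a + i b] are the Pauli coordinates of [phi psi^*], and their conjugates those of its adjoint. *)
pose x k : C := (a k +i* b k)%C; pose y k : C := (a k -i* b k)%C.
have xE : phi *m adjm psi = sigma x.
  rewrite [x]tripleE sigmaE; apply/matrixP => i j; rewrite !mxE big_ord1 !mxE /x /a /b /triple /=.
  case: i => [[|[|//]] ?]; case: j => [[|[|//]] ?] /=;
    by apply: complex_eqP; rewrite !ReImE /=; field.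
have yE : psi *m adjm phi = sigma y.
  rewrite [y]tripleE sigmaE; apply/matrixP => i j; rewrite !mxE big_ord1 !mxE /y /a /b /triple /=.
  case: i => [[|[|//]] ?]; case: j => [[|[|//]] ?] /=;
    by apply: complex_eqP; rewrite !ReImE /=; field.
pose z k : C := (n k / 2)%:C%C.
have psiE : psi *m adjm psi = (N / 2)%:C%C%:M + sigma z.
  rewrite [z]tripleE sigmaE; apply/matrixP => i j; rewrite !mxE big_ord1 !mxE /z /n /triple /=.
  case: i => [[|[|//]] ?]; case: j => [[|[|//]] ?] /=;
    by apply: complex_eqP; rewrite !ReImE /= /N; field.
have phiE : phi *m adjm phi = (N / 2)%:C%C%:M - sigma z.
  rewrite [z]tripleE sigmaE; apply/matrixP => i j; rewrite !mxE big_ord1 !mxE /z /n /triple /=.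
  case: i => [[|[|//]] ?]; case: j => [[|[|//]] ?] /=;
    by apply: complex_eqP; rewrite !ReImE /= /N; field.
have := dissipative_flip psi phi N N0 Npsi Nphi.
have := dissipative_flip phi psi N N0 Nphi Npsi.
rewrite xE yE psiE phiE {xE yE psiE phiE Npsi Nphi}.
have real := restrT_real.
(* As [x] and [y] are conjugate, the real part of [u i * v j] is [a i * a j + b i * b j] in either
   order. *)
have flipE u v : (u = x /\ v = y) \/ (u = y /\ v = x) ->
    complex.Re (\tr (sigma u *m L (sigma v))) =
      2 * (qform (restrT L) a + qform (restrT L) b).
  move=> uv; rewrite tr_sigma // cReM Im2 mul0r subr0 Re2 Re_form //; congr (_ * _).
  rewrite /qform -big_split; apply: eq_bigr => i _; rewrite -big_split; apply: eq_bigr => j _ /=.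
  by case: uv => -[-> ->] /=; ring.
rewrite (flipE x y) ?(flipE y x); [|by right|by left].
have zE : complex.Re (\tr (sigma z *m L (sigma z))) = qform (restrT L) n / 2.
  rewrite tr_sigma // cReM Im2 mul0r subr0 Re2 Re_form // mulr_sumr mulr_suml.
  apply: eq_bigr => i _; rewrite mulr_sumr mulr_suml; apply: eq_bigr => j _ /=.
  by field.
(* The terms pairing [sigma z] with the image of the scalar matrix cancel by opposite signs; those
   with the scalar matrix on the left vanish because [L] has traceless values. *)
have trE : complex.Re (\tr (((N / 2)%:C%C%:M + sigma z) *m L ((N / 2)%:C%C%:M + sigma z)))
   + complex.Re (\tr (((N / 2)%:C%C%:M - sigma z) *m L ((N / 2)%:C%C%:M - sigma z)))
   = qform (restrT L) n.
  rewrite -(divfK (_ : 2 != 0) (qform _ n)) // -zE.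
  move: (sigma z) (N / 2) => S k.
  have LB U V : L (U - V) = L U - L V.
    by rewrite linmapD -scaleN1r linmapZ scaleN1r.
  rewrite LB linmapD.
  have trD (U V : 'M[C]_2) : complex.Re (\tr (U + V)) = complex.Re (\tr U) + complex.Re (\tr V).
    by rewrite (raddfD (@mxtrace _ 2)) cReD.
  have trN (U : 'M[C]_2) : complex.Re (\tr (- U)) = - complex.Re (\tr U).
    by rewrite (raddfN (@mxtrace _ 2)) cReN.
  have trk (U : 'M[C]_2) : complex.Re (\tr (k%:C%C%:M *m L U)) = 0.
    by rewrite mul_scalar_mx mxtraceZ trL mulr0.
  move: (trk S) (trk k%:C%C%:M) => {trk}.
  move: (L S) (L k%:C%C%:M) => U V; move: (k%:C%C%:M) => K h1 h2.
  rewrite mulmxBl mulmxDl !mulmxBr !mulmxDr !(trD, trN) h1 h2.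
  by ring.
move: trE.
move: (complex.Re _) (complex.Re _) (qform _ a) (qform _ b) (qform _ n) => *; lra.
Qed.

(* With [r] the norm of [(a, b, c)], the spinor [(r + c, a + i b)] has Bloch
   vector [2 (r + c) (a, b, c)]; it does not vanish when [0 <= c] and [0 < r]. *)
Lemma bloch_upper (a b c : R) : 0 <= c ->
  2 * ((a ^+ 2 + b ^+ 2 + c ^+ 2) * complex.Re (\tr (restrT L)))
    <= 3 * qform (restrT L) (triple a b c).
Proof.
move=> c0; set r := Num.sqrt (a ^+ 2 + b ^+ 2 + c ^+ 2).
have nn0 : 0 <= a ^+ 2 + b ^+ 2 + c ^+ 2 by rewrite !addr_ge0 ?sqr_ge0.
have r2 : r ^+ 2 = a ^+ 2 + b ^+ 2 + c ^+ 2 by rewrite sqr_sqrtr.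
(* At the zero vector the spinor vanishes too, but both sides are then [0]. *)
have [r0|rN0] := eqVneq r 0.
  have nn : a ^+ 2 + b ^+ 2 + c ^+ 2 = 0 by rewrite -r2 r0 expr0n.
  have [a0 b0 c00] : [/\ a = 0, b = 0 & c = 0].
    have /eqP := nn; rewrite !paddr_eq0 ?addr_ge0 ?sqr_ge0 // !sqrf_eq0.
    by move=> /andP[/andP[/eqP -> /eqP ->] /eqP ->].
  rewrite nn a0 b0 c00 /qform !big_ord_recl !big_ord0 /triple /=.
  by rewrite !(mul0r, addr0, mulr0).
have r0 : 0 < r by rewrite lt_neqAle eq_sym rN0 sqrtr_ge0.
have rc0 : 0 < r + c by rewrite ltr_wpDr.
have NE : (r + c) ^+ 2 + a ^+ 2 + b ^+ 2 = 2 * (r + c) * r by ring: r2.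
have N0 : 0 < (r + c) ^+ 2 + a ^+ 2 + b ^+ 2 by rewrite NE !mulr_gt0.
have := bloch_spinor (r + c) a b N0.
rewrite NE (_ : triple _ _ _ = fun k => (2 * (r + c)) * triple a b c k); last first.
  apply/funext => -[[|[|[|//]]] ?]; rewrite /triple /= //; try by ring.
  by ring: r2.
rewrite qformZ -r2 => h.
(* The factor comes on the left from the squared norm of the spinor, on the right from the scaling
   of its Bloch vector. *)
rewrite -(@ler_pM2l _ ((2 * (r + c)) ^+ 2)) ?exprn_gt0 ?mulr_gt0 //.
move: h; rewrite exprMn -!mulrA.
move: (qform _ _) => x.
by move: (complex.Re _) => y h; lra.
Qed.

(** Both sides are even in [n], so the third coordinate may be taken nonnegative. *)
Lemma bloch_bound (n : 'I_3 -> R) :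
  2 * ((\sum_i n i ^+ 2) * complex.Re (\tr (restrT L))) <= 3 * qform (restrT L) n.
Proof.
rewrite !big_ord_recl big_ord0 addr0 addrA [in qform _ _](tripleE _ n).
move: (n _) (n _) (n _) => c b a.
have [c0|c0] := leP 0 c; first exact: bloch_upper.
have := bloch_upper (- a) (- b) (- c).
rewrite !sqrrN (_ : triple (- a) _ _ = fun k => -1 * triple a b c k); last first.
  by apply/funext => -[[|[|[|//]]] ?]; rewrite /triple /= mulN1r.
by rewrite qformZ sqrrN expr1n mul1r; apply; rewrite oppr_ge0 ltW.
Qed.

(** * From Bloch vectors to eigenvalues *)

(** For a row eigenvector [v = x + i y] of the real matrix [A], the real part of [v A v^*] is both
    [qform A x + qform A y] and [Re l] times the squared norm [S]. *)
Lemma eigenvalue_bound (l : C) : eigenvalue (restrT L) l ->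
  2 * complex.Re (\tr (restrT L)) <= 3 * complex.Re l.
Proof.
move=> /eigenvalueP[v vA v0].
have real := restrT_real.
pose x k := complex.Re (v 0 k); pose y k := complex.Im (v 0 k).
pose S := \sum_k (x k ^+ 2 + y k ^+ 2).
have S0 : 0 < S.
  rewrite lt_neqAle sumr_ge0 ?andbT => [|k _]; last by rewrite addr_ge0 ?sqr_ge0.
  rewrite eq_sym; apply: contra v0 => /eqP S0; apply/eqP/rowP => k; rewrite mxE.
  have /eqP : x k ^+ 2 + y k ^+ 2 = 0.
    by apply: (psumr_eq0P _ S0) => // i _; rewrite addr_ge0 ?sqr_ge0.
  rewrite paddr_eq0 ?sqr_ge0 // !sqrf_eq0 => /andP[/eqP xk /eqP yk].
  exact: complex_eqP.
have : complex.Re (\sum_i \sum_j v 0 i * (v 0 j)^*%C * restrT L i j) = complex.Re l * S.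
  transitivity (complex.Re (\sum_j (v *m restrT L) 0 j * (v 0 j)^*%C)).
    congr complex.Re; rewrite exchange_big; apply: eq_bigr => j _.
    rewrite mxE mulr_suml; apply: eq_bigr => i _ /=; ring.
  rewrite vA /S mulr_sumr (raddf_sum (@complex.Re R)); apply: eq_bigr => j _.
  rewrite mxE /x /y; case: (v 0 j) l {vA} => [a b] [c d] /=; ring.
rewrite Re_form // => E.
have : qform (restrT L) x + qform (restrT L) y = complex.Re l * S.
  rewrite -E /qform -big_split; apply: eq_bigr => i _; rewrite -big_split.
  by apply: eq_bigr => j _ /=; rewrite cReJ cImJ /x /y; ring.
have := bloch_bound x; have := bloch_bound y.
move: (qform _ x) (qform _ y) => qx qy hy hx qE.
rewrite -(@ler_pM2r _ S) // -[X in _ <= X]mulrA -qE /S big_split /=.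
by move: hx hy; move: (complex.Re _) => t; lra.
Qed.

End Generator.

End Qubit.

Theorem theorem1 (R : realType) (L Ld : 'M[R[i]]_2 -> 'M[R[i]]_2)
  (l : 'I_3 -> R[i]) :
  linmap L ->
  (forall X, \tr (L X) = 0) ->
  is_dual Ld L ->
  (forall t : R, 0 <= t -> unital_schwarz (expmap t Ld)) ->
  char_poly (restrT L) = \prod_(k < 3) ('X - (l k)%:P) ->
  forall k : 'I_3,
    - complex.Re (l k) <= 2 / 3 * (\sum_(m < 3) - complex.Re (l m)).
Proof.
move=> linL trL dLd sch charE k.
have eig : eigenvalue (restrT L) (l k).
  by rewrite eigenvalue_root_char charE rootE horner_prod (bigD1 k) //= hornerXsubC subrr mul0r.
(* The coefficient of degree two of the characteristic polynomial is minus the trace, and also minus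
   the sum of the roots. *)
have trE : \tr (restrT L) = \sum_m l m.
  have := char_poly_trace (restrT L) isT; rewrite charE.
  rewrite -(big_map l predT (fun a => 'X - a%:P)) -(big_map l predT id).
  have szl : size (map l (index_enum 'I_3)) = 3.
    by rewrite size_map [index_enum _]unlock -enumT size_enum_ord.
  have := @coefPn_prod_XsubC _ (map l (index_enum 'I_3)); rewrite szl => -> // /eqP.
  by rewrite eqr_opp => /eqP ->.
have := eigenvalue_bound R L Ld linL trL dLd sch _ eig.
rewrite trE (raddf_sum (@complex.Re R)) sumrN /=.
by move: (\sum_m _) (complex.Re _) => s t; lra.
Qed.
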